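(* Let $S_1 = (P_r, \sigma_1)$ and $S_2 = (P_s, \sigma_2)$ be signed paths on $r$ and $s$ vertices respectively, and let $S = S_1 \boxtimes S_2$ be their strong product. If $r > 1$ or $s > 1$, then $\chi'(S) = \Delta(S)$.
   Context: All graphs are simple, finite and undirected; $P_r$ is the path on $r$ vertices. A signed graph is a pair $S=(G,\sigma)$ where $G$ is a graph and $\sigma\colon E(G)\to\{+1,-1\}$; $G$ is the underlying graph. $V(S)$, $E(S)$ and $\Delta(S)$ (maximum degree) refer to the underlying graph. An incidence is a pair $v\text{:}e$ of a vertex $v$ and an edge $e$ having $v$ as an endpoint; $I(G)$ is the set of all incidences. For a positive integer $k$ let $M_k=\{0,\pm1,\ldots,\pm l\}$ if $k=2l+1$ and $M_k=\{\pm1,\ldots,\pm l\}$ if $k=2l$. A $k$-edge-coloring of $S=(G,\sigma)$ is a function $f\colon I(G)\to M_k$ such that $f(u\text{:}uv)=-\sigma(uv)f(v\text{:}uv)$ for each edge $uv$, and $f(u\text{:}uv_1)\neq f(u\text{:}uv_2)$ for any two distinct edges $uv_1\neq uv_2$ at a common vertex $u$. The chromatic index $\chi'(S)$ is the smallest $k$ for which $S$ has a $k$-edge-coloring. The strong product $S_1\boxtimes S_2$ of signed graphs $S_1=(G_1,\sigma_1)$, $S_2=(G_2,\sigma_2)$ is the signed graph with vertex set $V(S_1)\times V(S_2)$ in which $(u,u')(v,v')$ is an edge iff one of the following holds: $u=v$ and $u'v'\in E(S_2)$ (sign $\sigma_2(u'v')$); $uv\in E(S_1)$ and $u'=v'$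 (sign $\sigma_1(uv)$); $uv\in E(S_1)$ and $u'v'\in E(S_2)$ (sign $\sigma_1(uv)\sigma_2(u'v')$). *)

(* Defs.v *)
From mathcomp Require Import all_boot all_order all_algebra.

Set Implicit Arguments.
Unset Strict Implicit.
Unset Printing Implicit Defensive.

Import GRing.Theory.

Local Open Scope ring_scope.

Record graph (V : finType) := Graph {
  adj : rel V;
  adj_sym : symmetric adj;
  adj_irr : irreflexive adj }.

(* The edge uv is represented by the two ordered pairs (u, v) and (v, u);
   values of [sgn] on non-adjacent pairs are irrelevant. *)
Record signing (V : finType) (G : graph V) := Signing {
  sgn : V -> V -> int;
  sgn_sym : forall u v, adj G u v -> sgn u v = sgn v u;
  sgn_pm1 : forall u v, adj G u v -> sgn u v = 1 \/ sgn u v = - 1 }.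

Record signed_graph (V : finType) := SignedGraph {
  underlying : graph V;
  sigma : signing underlying }.

Definition degree (V : finType) (G : graph V) (v : V) : nat :=
  #|[set w | adj G v w]|.

Definition max_degree (V : finType) (S : signed_graph V) : nat :=
  \max_(v : V) degree (underlying S) v.

(* M_k: 0 is available exactly when k is odd. *)
Definition color_set (k : nat) : pred int :=
  [pred c : int | (`|c| <= k./2)%N && (odd k || (c != 0))].

(* In a simple graph, the incidence u:uv is determined by the ordered pair
   (u, v) of adjacent vertices: [f u v] is the color of u:uv, and values of [f]
   on non-adjacent pairs are irrelevant. *)
Definition edge_coloring (V : finType) (S : signed_graph V) (k : nat)
    (f : V -> V -> int) : Prop :=
  [/\ forall u v, adj (underlying S) u v -> f u v \in color_set k,
      forall u v, adj (underlying S) u v ->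
        f u v = - sgn (sigma S) u v * f v u
    & forall u v1 v2, adj (underlying S) u v1 -> adj (underlying S) u v2 ->
        v1 <> v2 -> f u v1 <> f u v2].

Definition edge_colorable (V : finType) (S : signed_graph V) (k : nat) : Prop :=
  exists f : V -> V -> int, edge_coloring S k f.

(* k is the least positive number of colors, i.e. chi'(S) = k. *)
Definition is_chromatic_index (V : finType) (S : signed_graph V) (k : nat) :
    Prop :=
  [/\ (0 < k)%N, edge_colorable S k
    & forall j : nat, (0 < j)%N -> edge_colorable S j -> (k <= j)%N].

Section StrongProduct.

Variables (V1 V2 : finType) (S1 : signed_graph V1) (S2 : signed_graph V2).

Let G1 := underlying S1.
Let G2 := underlying S2.

Definition strong_adj : rel (V1 * V2) := fun x y =>
  [|| (x.1 == y.1) && adj G2 x.2 y.2,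
      adj G1 x.1 y.1 && (x.2 == y.2)
    | adj G1 x.1 y.1 && adj G2 x.2 y.2].

Fact strong_adj_sym : symmetric strong_adj.
Proof.
move=> x y; rewrite /strong_adj (eq_sym y.1) (eq_sym y.2).
by rewrite (adj_sym G1 y.1) (adj_sym G2 y.2).
Qed.

Fact strong_adj_irr : irreflexive strong_adj.
Proof. by move=> x; rewrite /strong_adj !adj_irr !andbF. Qed.

Definition strong_graph : graph (V1 * V2)%type :=
  Graph strong_adj_sym strong_adj_irr.

Definition strong_sgn (x y : V1 * V2) : int :=
  if x.1 == y.1 then sgn (sigma S2) x.2 y.2
  else if x.2 == y.2 then sgn (sigma S1) x.1 y.1
  else sgn (sigma S1) x.1 y.1 * sgn (sigma S2) x.2 y.2.

Fact strong_sgn_sym (x y : V1 * V2) :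
  adj strong_graph x y -> strong_sgn x y = strong_sgn y x.
Proof.
rewrite /= /strong_adj /strong_sgn (eq_sym y.1) (eq_sym y.2).
case: (eqVneq x.1 y.1) => [->|_] /=.
  by rewrite adj_irr /= orbF; apply: sgn_sym.
case: (eqVneq x.2 y.2) => [->|_] /=.
  by rewrite adj_irr andbF orbF andbT; apply: sgn_sym.
by rewrite andbF /= => /andP[a1 a2]; rewrite (sgn_sym _ a1) (sgn_sym _ a2).
Qed.

Fact strong_sgn_pm1 (x y : V1 * V2) :
  adj strong_graph x y -> strong_sgn x y = 1 \/ strong_sgn x y = - 1.
Proof.
rewrite /= /strong_adj /strong_sgn.
case: (eqVneq x.1 y.1) => [->|_] /=.
  by rewrite adj_irr /= orbF; apply: sgn_pm1.
case: (eqVneq x.2 y.2) => [->|_] /=.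
  by rewrite adj_irr andbF orbF andbT; apply: sgn_pm1.
rewrite andbF /= => /andP[a1 a2].
by case: (sgn_pm1 (sigma S1) a1) => ->; case: (sgn_pm1 (sigma S2) a2) => ->;
  [left|right|right|left].
Qed.

Definition strong_product : signed_graph (V1 * V2)%type :=
  SignedGraph (Signing strong_sgn_sym strong_sgn_pm1).

End StrongProduct.

Section PathGraph.

Variable r : nat.

Definition path_adj : rel 'I_r := fun i j => (i.+1 == j) || (j.+1 == i).

Fact path_adj_sym : symmetric path_adj.
Proof. by move=> i j; rewrite /path_adj orbC. Qed.

Fact path_adj_irr : irreflexive path_adj.
Proof. by move=> i; rewrite /path_adj orbb gtn_eqF. Qed.

Definition path_graph : graph 'I_r := Graph path_adj_sym path_adj_irr.

End PathGraph.

(* Main.v *)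
Require Import Defs.
From mathcomp Require Import all_boot all_order all_algebra.
From mathcomp Require Import zify.

(** A signed path is balanced, that is, a switching of the all-positive path,
    and balance passes to strong products; so it suffices to color the
    all-positive strong product. There a coloring is antisymmetric,
    [f u v = - f v u]: a pair of colors [c], [- c] is a subgraph of maximum degree
    2 with oriented paths and cycles, and 0 is a matching. In the king's graph
    [P_r * P_s] with [3 <= r, s] the four directions of the edges are four such
    subgraphs, and thinner boards are similar. *)

Set Implicit Arguments.
Unset Strict Implicit.
Unset Printing Implicit Defensive.

Import GRing.Theory.

Local Open Scope ring_scope.

(** Pigeonhole: the colors at [v] are pairwise distinct members of M_k, which has exactly k
    elements. *)
Lemma degree_le_colors (V : finType) (S : signed_graph V) (k : nat)
    (f : V -> V -> int) (v : V) :
  edge_coloring S k f -> (degree (underlying S) v <= k)%N.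
Proof.
case=> f_col _ f_inj.
(* M_k as a list: 1, ..., l, then -1, ..., -l (since [Negz i] is -(i+1)), then 0 once if k is
   odd. *)
pose colors := [seq i.+1%:Z | i <- iota 0 k./2] ++
  [seq Negz i | i <- iota 0 k./2] ++ nseq (odd k) 0.
have -> : k = size colors.
  by rewrite !size_cat !size_map !size_iota size_nseq; lia.
rewrite /degree cardE -(size_map (f v)); apply: uniq_leq_size.
  rewrite map_inj_in_uniq ?enum_uniq // => a b.
  rewrite !mem_enum !inE => va vb eq_f; apply: contra_eq eq_f => /eqP ab.
  exact/eqP/f_inj.
move=> _ /mapP[w + ->]; rewrite mem_enum inE => /f_col.
rewrite inE !mem_cat mem_nseq => /andP[].
case: (f v w) => [[|n]|n] /= n_le; first by case: (odd k); rewrite ?orbT.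
- move=> _; apply/orP; left; apply/mapP.
  by exists n => //; rewrite mem_iota.
- move=> _; apply/orP; right; apply/orP; left; apply/mapP.
  by exists n => //; rewrite mem_iota.
Qed.

(** A k-coloring bounds every degree by k, so a vertex of degree k makes k both the maximum degree
    and the least number of colors. *)
Lemma is_chromatic_index_max_degree (V : finType) (S : signed_graph V)
    (k : nat) (v : V) :
  (0 < k)%N -> degree (underlying S) v = k -> edge_colorable S k ->
  is_chromatic_index S (max_degree S).
Proof.
move=> k_gt0 deg_v S_col.
have max_le j : edge_colorable S j -> (max_degree S <= j)%N.
  by case=> f f_col; apply/bigmax_leqP => w _; apply: degree_le_colors f_col.
suff -> : max_degree S = k.
  by split=> // j _ [f f_col]; rewrite -deg_v; apply: degree_le_colors f_col.
apply/eqP; rewrite eqn_leq max_le //= -deg_v.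
exact: (leq_bigmax (F := degree (underlying S))).
Qed.

(** Balance in potential form: switching at the vertices where [p] is true makes every sign
    positive. *)
Definition balanced (V : finType) (S : signed_graph V) : Prop :=
  exists p : V -> bool, forall u v, adj (underlying S) u v ->
    sgn (sigma S) u v = (-1) ^+ (p u (+) p v).

Definition positive_coloring (V : finType) (e : rel V) (k : nat)
    (f : V -> V -> int) : Prop :=
  [/\ forall u v, e u v -> f u v \in color_set k,
      forall u v, e u v -> f u v = - f v u
    & forall u v w, e u v -> e u w -> f u v = f u w -> v = w].

(** Switching at [u] negates all colors at [u]: M_k is closed under negation, and distinct colors
    stay distinct. *)
Lemma balanced_edge_colorable (V : finType) (S : signed_graph V) (k : nat)
    (f : V -> V -> int) :
  balanced S -> positive_coloring (adj (underlying S)) k f ->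
  edge_colorable S k.
Proof.
case=> p sgn_p [f_col f_anti f_inj].
exists (fun u v => (-1) ^+ p u * f u v); split.
- move=> u v /f_col; rewrite !inE.
  by rewrite abszMsign mulf_eq0 signr_eq0.
- move=> u v uv; rewrite (sgn_p _ _ uv) (f_anti _ _ uv) signr_addb.
  by rewrite mulrN mulNr -mulrA (mulrA _ _ (f v u)) -expr2 sqrr_sign mul1r.
- move=> u v w uv uw vw /(congr1 (fun c => (-1) ^+ p u * c)).
  by rewrite !signrMK => /(f_inj _ _ _ uv uw).
Qed.

(** The potentials add up; a coordinate common to both ends of an edge cancels. *)
Lemma strong_product_balanced (V1 V2 : finType) (S1 : signed_graph V1)
    (S2 : signed_graph V2) :
  balanced S1 -> balanced S2 -> balanced (strong_product S1 S2).
Proof.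
move=> [p1 sgn1] [p2 sgn2].
exists (fun x => p1 x.1 (+) p2 x.2) => -[x1 x2] [y1 y2].
rewrite /= /strong_adj /strong_sgn /=.
case: eqVneq => [<-|_] /=.
  by rewrite adj_irr /= orbF => /sgn2 ->; case: (p1 x1); rewrite ?addNb ?addbN ?negbK.
case: eqVneq => [<-|_] /=.
  rewrite adj_irr andbF orbF andbT => /sgn1 ->.
  by case: (p2 x2); rewrite ?addbT ?addbF ?addNb ?addbN ?negbK.
rewrite andbF => /andP[/sgn1 -> /sgn2 ->].
by rewrite addbACA -signr_addb.
Qed.

Lemma path_balanced (r : nat) (sigma1 : signing (path_graph r)) :
  balanced (SignedGraph sigma1).
Proof.
case: r sigma1 => [|r] sigma1; first by exists xpredT => -[].
pose neg i j := sgn sigma1 i j == -1.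
(* The potential is the parity of the number of negative edges before vertex [i]; for a vertex [i]
   all arguments of [inord] are in range. *)
pose p (i : nat) := \big[addb/false]_(k < i) neg (inord k) (inord k.+1).
have sgnE i j : adj (path_graph r.+1) i j -> sgn sigma1 i j = (-1) ^+ neg i j.
  by rewrite /neg => /(sgn_pm1 sigma1)[] ->.
have pS (i j : 'I_r.+1) : i.+1 = j :> nat -> neg i j = p i (+) p j.
  move=> ij; rewrite -ij /p big_ord_recr /= ij !inord_val.
  by rewrite addbA addbb.
exists (fun i : 'I_r.+1 => p i) => i j ij /=; rewrite (sgnE _ _ ij).
have /orP[/eqP/pS -> //|/eqP/pS ji] := ij.
by rewrite addbC -ji /neg (sgn_sym sigma1 ij).
Qed.

(** The closed neighborhood of [x] is the product of the closed neighborhoods of its coordinates. *)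
Lemma degree_strong_graph (V1 V2 : finType) (S1 : signed_graph V1)
    (S2 : signed_graph V2) (x : V1 * V2) :
  (degree (strong_graph S1 S2) x).+1 =
  ((degree (underlying S1) x.1).+1 * (degree (underlying S2) x.2).+1)%N.
Proof.
pose N (V : finType) (G : graph V) v := v |: [set w | adj G v w].
have cardN (V : finType) (G : graph V) v : #|N V G v| = (degree G v).+1.
  by rewrite cardsU1 inE adj_irr.
rewrite -!cardN -cardsX; apply: eq_card => y.
rewrite !inE /= /strong_adj -!(eq_sym y.1) -!(eq_sym y.2).
by case: x y => [x1 x2] [y1 y2] /=; rewrite xpair_eqE;
  case: (y1 == x1); case: (y2 == x2); case: (adj _ x1 y1); case: (adj _ x2 y2).
Qed.

Lemma path_degree (r : nat) :
  (0 < r)%N -> exists v, degree (path_graph r) v = minn r.-1 2.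
Proof.
case: r => [//|[|[|r]]] _.
- exists ord0; apply: eq_card0 => i; rewrite !inE /= /path_adj.
  by rewrite !(ord1 i).
- exists ord0; rewrite /degree.
  have -> : [set w | adj (path_graph 2) ord0 w] = [set ord_max].
    by apply/setP => -[[|[|i]] i_lt]; rewrite !inE.
  by rewrite cards1.
- pose o n : 'I_r.+3 := inord n.
  have oE n : (n < 3)%N -> o n = n :> nat by move=> n3; rewrite inordK //; lia.
  exists (o 1%N); rewrite /degree.
  have -> : [set w | adj (path_graph r.+3) (o 1%N) w] = [set o 0%N; o 2%N].
    apply/setP => i; rewrite !inE /= /path_adj -!val_eqE /= !oE //; lia.
  by rewrite cards2 -val_eqE /= !oE.
Qed.

Section StrongPaths.

Variables (r s : nat) (sigma1 : signing (path_graph r)).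
Variable (sigma2 : signing (path_graph s)).

Let S := strong_product (SignedGraph sigma1) (SignedGraph sigma2).
Let adjS : rel ('I_r * 'I_s) := adj (underlying S).

(** The color depends only on the king's move from [x] to [y]: an odd [F] gives antisymmetry, and
    injectivity on the moves available at one vertex gives distinct colors. *)
Definition offset_coloring (F : int -> int -> int) (x y : 'I_r * 'I_s) : int :=
  F ((y.1 : nat)%:Z - (x.1 : nat)%:Z) ((y.2 : nat)%:Z - (x.2 : nat)%:Z).

Local Ltac offset_tac :=
  rewrite /positive_coloring /offset_coloring /adjS /= /strong_adj /= /path_adj;
  split=> [[[? ?] [? ?]] [[? ?] [? ?]]|[[? ?] [? ?]] [[? ?] [? ?]]|
           [[? ?] [? ?]] [[? ?] [? ?]] [[? ?] [? ?]]];
  [ rewrite inE /= -!val_eqE /=; repeat case: ifP; lia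
  | rewrite /= -!val_eqE /=; repeat case: ifP; lia
  | rewrite /= -!val_eqE /=; repeat case: ifP; move=> *;
    congr pair; apply: val_inj => /=; lia ].

(** Balanced ternary: for a, b in {-1, 0, 1} the number a + 3b takes each value from -4 to 4 once,
    and 0 only at the null move. *)
Lemma offset_coloring8 : (2 < r)%N -> (2 < s)%N ->
  positive_coloring adjS 8 (offset_coloring (fun a b => a + 3 * b)).
Proof. move=> r3 s3; offset_tac. Qed.

(** With two rows, only one nonzero [a] is available at each vertex. Edges inside a row get 1 and
    -1, rungs get 0, diagonals 2 and -2. *)
Lemma offset_coloring5 : r = 2%N ->
  positive_coloring adjS 5
    (offset_coloring (fun a b => if a == 0 then b else 2 * b)).
Proof. move=> r2; offset_tac. Qed.

(** In this complete graph on four vertices, each vertex has only one nonzero [b], so diagonals can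
    reuse the colors 1 and -1 with the opposite sign. *)
Lemma offset_coloring3 : r = 2%N -> s = 2%N ->
  positive_coloring adjS 3
    (offset_coloring (fun a b => if a == 0 then b else - b)).
Proof. move=> r2 s2; offset_tac. Qed.

Lemma offset_coloring2 : r = 1%N ->
  positive_coloring adjS 2 (offset_coloring (fun _ b => b)).
Proof. move=> r1; offset_tac. Qed.

Lemma offset_coloring1 : r = 1%N -> s = 2%N ->
  positive_coloring adjS 1 (offset_coloring (fun _ _ => 0)).
Proof. move=> r1 s2; offset_tac. Qed.

Lemma strong_paths_coloring : (0 < r)%N -> (r <= s)%N -> (1 < s)%N ->
  exists f, positive_coloring adjS
    ((minn r.-1 2).+1 * (minn s.-1 2).+1).-1 f.
Proof.
move=> r0 rs s1.
have [s2|s3] : s = 2%N \/ (2 < s)%N by lia.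
  have -> : minn s.-1 2 = 1%N by lia.
  have [r1|r2] : r = 1%N \/ r = 2%N by lia.
    have -> : minn r.-1 2 = 0%N by lia.
    by eexists; apply: offset_coloring1.
  have -> : minn r.-1 2 = 1%N by lia.
  by eexists; apply: offset_coloring3.
have -> : minn s.-1 2 = 2%N by lia.
have [r1|[r2|r3]] : r = 1%N \/ r = 2%N \/ (2 < r)%N by lia.
- have -> : minn r.-1 2 = 0%N by lia.
  by eexists; apply: offset_coloring2.
- have -> : minn r.-1 2 = 1%N by lia.
  by eexists; apply: offset_coloring5.
- have -> : minn r.-1 2 = 2%N by lia.
  by eexists; apply: offset_coloring8.
Qed.

End StrongPaths.

Lemma positive_coloring_swap (V1 V2 : finType) (S1 : signed_graph V1)
    (S2 : signed_graph V2) (k : nat) (f : V2 * V1 -> V2 * V1 -> int) :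
  positive_coloring (adj (strong_graph S2 S1)) k f ->
  positive_coloring (adj (strong_graph S1 S2)) k
    (fun x y => f (swap_pair x) (swap_pair y)).
Proof.
have swapE x y : adj (strong_graph S1 S2) x y ->
    adj (strong_graph S2 S1) (swap_pair x) (swap_pair y).
  by rewrite /= /strong_adj /= => /or3P[] /andP[-> ->]; rewrite ?orbT.
case=> f_col f_anti f_inj; split.
- by move=> x y /swapE /f_col.
- by move=> x y /swapE /f_anti.
- by move=> x y z /swapE xy /swapE xz /(f_inj _ _ _ xy xz) /(can_inj swap_pairK).
Qed.

Theorem theorem23 (r s : nat)
    (sigma1 : signing (path_graph r)) (sigma2 : signing (path_graph s)) :
  (0 < r)%N -> (0 < s)%N -> (1 < r)%N \/ (1 < s)%N ->
  let S := strong_product (SignedGraph sigma1) (SignedGraph sigma2) in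
  is_chromatic_index S (max_degree S).
Proof.
move=> r0 s0 rs S.
have [v1 deg1] := path_degree r0; have [v2 deg2] := path_degree s0.
have degE : degree (underlying S) (v1, v2) =
    ((minn r.-1 2).+1 * (minn s.-1 2).+1).-1.
  by apply: succn_inj; rewrite degree_strong_graph deg1 deg2.
apply: is_chromatic_index_max_degree degE _; first by nia.
have [f f_col] : exists f, positive_coloring (adj (underlying S))
    ((minn r.-1 2).+1 * (minn s.-1 2).+1).-1 f.
  have [r_le|s_lt] := leqP r s; first by apply: strong_paths_coloring; lia.
  (* If s < r, the factors trade places; the number of colors is symmetric in them. *)
  have [||| f f_col] := @strong_paths_coloring s r sigma2 sigma1; try lia.
  by eexists; rewrite mulnC; apply: positive_coloring_swap f_col.
apply: balanced_edge_colorable f_col.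
by apply: strong_product_balanced; apply: path_balanced.
Qed.
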